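(* Let $\tau>0$ and let $f\colon\mathbb{R}\to\mathbb{R}$ be a function of bounded variation (on each compact interval), continuous from the right, which is either constant or periodic with minimal period $\tau$. Let $U\colon Y\to Y$ be the monodromy operator of $x(t)=f(t)x(t-\tau)$ and let $U_{\mathbb{C}}\colon Y_{\mathbb{C}}\to Y_{\mathbb{C}}$ be its complexification. Then the point spectrum of $U_{\mathbb{C}}$ is $$\sigma_p(U_{\mathbb{C}})=\{\lambda\in\sigma(U_{\mathbb{C}})\mid (f^{-1}(\lambda))^{\circ}\neq\emptyset\}=\{\lambda\in\sigma(U_{\mathbb{C}})\mid f^{-1}(\lambda)\text{ contains a segment}\}.$$
   Context: $Y:=NBV([-\tau,0];\mathbb{R})$ is the Banach space, with the total variation norm, of functions $\phi\colon[-\tau,0]\to\mathbb{R}$ of bounded variation that are continuous from the right and satisfy $\phi(0)=0$. Its complexification is $Y_{\mathbb{C}}\cong NBV([-\tau,0];\mathbb{C})$ (the same with complex values). For a function $x$ the segment of $x$ at $t$ is $x_t(\theta):=x(t+\theta)$, $\theta\in[-\tau,0]$. For $\phi\in Y$, let $x(\cdot;\phi)$ be the unique solution of the initial value problem $x(t)=f(t)x(t-\tau)$ for $t\ge 0$, $x_0=\phi$. The monodromy operator is $U\phi:=x_\tau(\cdot;\phi)$. Convention on the normalization at $0$: the initial condition prescribes $x(\theta)=\phi(\theta)$ for $\theta\in[-\tau,0)$, the equation prescribes $x(t)$ for $t\ge 0$, and segments are regarded as elements of $Y$ by assigning them the value $0$ at $\theta=0$; so $(U\phi)(\theta)=x(\tau+\theta;\phi)$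 for $\theta\in[-\tau,0)$ and $(U\phi)(0)=0$. The complexified operator is $U_{\mathbb{C}}(\phi_{\Re}+\mathrm{i}\phi_{\Im}):=U\phi_{\Re}+\mathrm{i}U\phi_{\Im}$ for $\phi_{\Re},\phi_{\Im}\in Y$. $\sigma(U_{\mathbb{C}})$ is the spectrum of $U_{\mathbb{C}}$; the point spectrum $\sigma_p(U_{\mathbb{C}})$ is the set of $\lambda\in\mathbb{C}$ such that $U_{\mathbb{C}}-\lambda I_{Y_{\mathbb{C}}}$ is not injective. $f^{-1}(\lambda)=\{t\in\mathbb{R}\mid f(t)=\lambda\}$, $S^{\circ}$ denotes the interior of $S\subset\mathbb{R}$ in $\mathbb{R}$, and a segment is an interval of positive length. *)

(* Defs.v *)
From HB Require Import structures.
From mathcomp Require Import all_boot all_order all_algebra.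
From mathcomp Require Import all_classical all_reals all_analysis.
From mathcomp Require Import complex.

Set Implicit Arguments.
Unset Strict Implicit.
Unset Printing Implicit Defensive.

Import Order.TTheory GRing.Theory Num.Theory.
Import numFieldNormedType.Exports.

Local Open Scope classical_set_scope.
Local Open Scope complex_scope.
Local Open Scope ring_scope.

Section spectrum.
Context {K : numFieldType} {V : normedModType K}.
Implicit Type T : V -> V.

Definition resolvent_set T : set K :=
  [set l | exists S : {linear V -> V},
    [/\ continuous S,
        forall v, S (T v - l *: v) = v &
        forall v, T (S v) - l *: S v = v]].

Definition spectrum T : set K := ~` resolvent_set T.

Definition point_spectrum T : set K :=
  [set l | ~ injective (fun v => T v - l *: v)].

End spectrum.

(* The library's `variation`, `bounded_variation` and `total_variation` are for
   real-valued functions; these are the same definitions with values in an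
   arbitrary normed group, convertible to the library's for values in R. *)
Section normed_variation.
Context {R : realType} {V : normedZmodType R}.
Implicit Types (a b : R) (f g : R -> V).

Definition nvariation a b f s : R := let F := f \o nth b (a :: s) in
  \sum_(0 <= n < size s) `|F n.+1 - F n|.

Definition nvariations a b f : set R :=
  [set nvariation a b f s | s in itv_partition a b].

Definition nbounded_variation a b f := has_ubound (nvariations a b f).

Definition ntotal_variation a b f : \bar R :=
  ereal_sup [set x%:E | x in nvariations a b f].

Lemma nvariation_ge0 a b f s : 0 <= nvariation a b f s.
Proof. exact: sumr_ge0. Qed.

Lemma nvariation_ub a b f s : nbounded_variation a b f ->
  itv_partition a b s -> nvariation a b f s <= fine (ntotal_variation a b f).
Proof.
move=> [M fM] ps.
have TM : (ntotal_variation a b f <= M%:E)%E.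
  by apply: ge_ereal_sup => _ [x xv <-]; rewrite lee_fin fM.
have vT : ((nvariation a b f s)%:E <= ntotal_variation a b f)%E.
  by apply: ereal_sup_ubound; exists (nvariation a b f s) => //; exists s.
by move: TM vT; case: (ntotal_variation a b f) => //= r _; rewrite lee_fin.
Qed.

Lemma fine_ntotal_variation_le a b f M : 0 <= M ->
  (forall s, itv_partition a b s -> nvariation a b f s <= M) ->
  fine (ntotal_variation a b f) <= M.
Proof.
move=> M0 fM.
have : (ntotal_variation a b f <= M%:E)%E.
  by apply: ge_ereal_sup => _ [x [s ps <-] <-]; rewrite lee_fin fM.
by case: (ntotal_variation a b f) => //= r; rewrite lee_fin.
Qed.

Lemma fine_ntotal_variation_ge0 a b f : nbounded_variation a b f ->
  0 <= fine (ntotal_variation a b f).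
Proof.
move=> bf; have [[s ps]|np] := pselect (exists s, itv_partition a b s).
  exact: le_trans (nvariation_ge0 _ _ _ s) (nvariation_ub bf ps).
rewrite /ntotal_variation (_ : nvariations a b f = set0).
  by rewrite image_set0 ereal_sup0.
by apply/seteqP; split => // x [s ps _]; apply: np; exists s.
Qed.

Lemma nvariationD a b f g s :
  nvariation a b (f + g) s <= nvariation a b f s + nvariation a b g s.
Proof.
rewrite -big_split /=; apply: ler_sum => i _.
by rewrite opprD addrACA ler_normD.
Qed.

Lemma nbounded_variationD a b f g : nbounded_variation a b f ->
  nbounded_variation a b g -> nbounded_variation a b (f + g).
Proof.
move=> [M fM] [N gN]; exists (M + N) => _ [s ps <-].
apply: (le_trans (nvariationD _ _ _ _ _)).
by rewrite lerD// ?fM ?gN//; exists s.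
Qed.

Lemma fine_ntotal_variationD a b f g : nbounded_variation a b f ->
  nbounded_variation a b g ->
  fine (ntotal_variation a b (f + g)) <=
  fine (ntotal_variation a b f) + fine (ntotal_variation a b g).
Proof.
move=> bf bg; apply: fine_ntotal_variation_le.
  by rewrite addr_ge0 ?fine_ntotal_variation_ge0.
move=> s ps; apply: (le_trans (nvariationD _ _ _ _ _)).
by rewrite lerD ?nvariation_ub.
Qed.

Lemma fine_ntotal_variation_eq0 a b f u : nbounded_variation a b f ->
  fine (ntotal_variation a b f) = 0 -> a <= u <= b -> f u = f b.
Proof.
move=> bf f0 /andP[]; rewrite le_eqVlt => /predU1P[<-|au];
  rewrite le_eqVlt => /predU1P[->//|ub].
- have := nvariation_ub bf (itv_partition1 ub).
  rewrite f0 /nvariation /= big_nat1 /= normr_le0 subr_eq0 => /eqP.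
  by move=> ->.
- have ps : itv_partition a b [:: u; b] by split => //=; rewrite au ub.
  have := nvariation_ub bf ps.
  rewrite f0 /nvariation /= big_nat_recr//= big_nat1 /= => fab.
  have : `|f b - f u| <= 0 by apply: le_trans fab; rewrite lerDr.
  by rewrite normr_le0 subr_eq0 => /eqP.
Qed.

End normed_variation.

Section nvariation_scale.
Context {R : realType} {V W : normedZmodType R}.
Implicit Types (a b c : R) (f : R -> V) (g : R -> W).

Lemma nvariation_scale a b c f g s : 0 <= c ->
  (forall u v, `|g u - g v| <= c * `|f u - f v|) ->
  nvariation a b g s <= c * nvariation a b f s.
Proof.
by move=> c0 gf; rewrite mulr_sumr; apply: ler_sum => i _; exact: gf.
Qed.

Lemma nbounded_variation_scale a b c f g : 0 <= c ->
  (forall u v, `|g u - g v| <= c * `|f u - f v|) ->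
  nbounded_variation a b f -> nbounded_variation a b g.
Proof.
move=> c0 gf [M fM]; exists (c * M) => _ [s ps <-].
apply: (le_trans (nvariation_scale _ _ _ c0 gf)).
by rewrite ler_wpM2l ?fM//; exists s.
Qed.

Lemma fine_ntotal_variation_scale a b c f g : 0 <= c ->
  (forall u v, `|g u - g v| <= c * `|f u - f v|) ->
  nbounded_variation a b f ->
  fine (ntotal_variation a b g) <= c * fine (ntotal_variation a b f).
Proof.
move=> c0 gf bf; apply: fine_ntotal_variation_le => [|s ps].
  by rewrite mulr_ge0 ?fine_ntotal_variation_ge0.
apply: (le_trans (nvariation_scale _ _ _ c0 gf)).
by rewrite ler_wpM2l ?nvariation_ub.
Qed.

End nvariation_scale.

(* A function on [-tau, 0] is represented by its extension by 0 to R, so that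
   equal functions are represented by equal terms. *)
Section nbv_real.
Context {R : realType} (tau : R).
Implicit Type f : R -> R.

Definition is_nbv f : Prop :=
  [/\ forall t, t \notin `[- tau, 0] -> f t = 0,
      bounded_variation (- tau) 0 f,
      forall t, t \in `[- tau, 0[ -> f @ t^'+ --> f t &
      f 0 = 0].

Definition nbv_pred : {pred R -> R} := fun f => `[< is_nbv f >].

Lemma nbv_submod_closed : submod_closed nbv_pred.
Proof.
split.
  apply/asboolP; split => // [|t _]; last exact: cvg_cst.
  exists 0 => _ [s _ <-]; rewrite /variation big1// => i _.
  by rewrite subrr normr0.
move=> l f g /asboolP[f0 bf cf fz] /asboolP[g0 bg cg gz]; apply/asboolP; split.
- by move=> t tI; rewrite /= !fctE f0// g0// scaler0 addr0.
- apply: (@nbounded_variationD R R) => //.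
  apply: (@nbounded_variation_scale R R R _ _ `|l| f) => // u v.
  by rewrite /= -normrM mulrBr.
- by move=> t tI; apply: cvgD; [apply: cvgZr; exact: cf|exact: cg].
- by rewrite !fctE fz gz scaler0 addr0.
Qed.

HB.instance Definition _ := GRing.isSubmodClosed.Build R (R -> R) nbv_pred
  nbv_submod_closed.

Record nbv := NBV { nbv_fun :> R -> R ; _ : nbv_fun \in nbv_pred }.

HB.instance Definition _ := [isSub for nbv_fun].
HB.instance Definition _ := [Choice of nbv by <:].
HB.instance Definition _ := [SubChoice_isSubLmodule of nbv by <:].

Lemma nbvP (f : nbv) : is_nbv f. Proof. by case: f => f /= /asboolP. Qed.

Definition nbv_norm (f : nbv) : R := fine (total_variation (- tau) 0 f).

Lemma nbv_normD (f g : nbv) : nbv_norm (f + g) <= nbv_norm f + nbv_norm g.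
Proof.
by apply: (@fine_ntotal_variationD R R); [case: (nbvP f)|case: (nbvP g)].
Qed.

Lemma nbv_normZ_le l (f : nbv) : nbv_norm (l *: f) <= `|l| * nbv_norm f.
Proof.
apply: (@fine_ntotal_variation_scale R R R); rewrite ?normr_ge0//; last first.
  by case: (nbvP f).
by move=> u v /=; rewrite -normrM mulrBr.
Qed.

Lemma nbv_normZ l (f : nbv) : nbv_norm (l *: f) = `|l| * nbv_norm f.
Proof.
apply/eqP; rewrite eq_le nbv_normZ_le /=; have [->|l0] := eqVneq l 0.
  rewrite normr0 mul0r; apply: (@fine_ntotal_variation_ge0 R R).
  by case: (nbvP (0 *: f)).
rewrite -ler_pdivlMl ?normr_gt0// -normfV.
apply: le_trans (nbv_normZ_le _ _).
by rewrite scalerA mulVf// scale1r.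
Qed.

Lemma nbv_norm_eq0 (f : nbv) : nbv_norm f = 0 -> f = 0.
Proof.
move=> f0; apply/val_inj/funext => t /=; have [zf bf _ f00] := nbvP f.
have [|tI] := boolP (t \in `[- tau, 0]); last by rewrite zf.
by rewrite in_itv /= => /(@fine_ntotal_variation_eq0 R R _ _ _ _ bf f0) ->.
Qed.

HB.instance Definition _ := Lmodule_isNormed.Build R nbv
  nbv_normD nbv_normZ nbv_norm_eq0.

Lemma nbv_normE (f : nbv) : `|f| = fine (total_variation (- tau) 0 f).
Proof. by []. Qed.

End nbv_real.

Section complex_cvg.
Context {R : realType}.
Implicit Types (f : R -> R[i]) (F : set_system R).

Lemma cvg_complexP f (l : R[i]) F : Filter F ->
  ((f : R -> R[i]^o) @ F --> (l : R[i]^o)) <->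
  (complex.Re (f t) @[t --> F] --> complex.Re l) /\
  (complex.Im (f t) @[t --> F] --> complex.Im l).
Proof.
move=> FF; split=> [fl|[fl1 fl2]].
  split; apply/cvgrPdist_lt => e e0.
    move/cvgrPdist_lt : fl => /(_ e%:C); rewrite ltcR => /(_ e0).
    apply: filterS => t /= lt_e; rewrite -ltcR; apply: le_lt_trans lt_e.
    apply: le_trans (normc_ge_Re _).
    by case: (l) => a b; case: (f t).
  move/cvgrPdist_lt : fl => /(_ e%:C); rewrite ltcR => /(_ e0).
  apply: filterS => t /= lt_e; rewrite -ltcR; apply: le_lt_trans lt_e.
  rewrite normc_def lecR -sqrtr_sqr ler_sqrt ?addr_ge0 ?sqr_ge0//.
  case: (l) => a b; case: (f t) => c d /=.
  by rewrite lerDr sqr_ge0.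
apply/cvgrPdist_lt => -[e e']; rewrite ltcE /= => /andP[/eqP -> e0].
have e20 : 0 < e / 2 by rewrite divr_gt0.
move/cvgrPdist_lt : fl1 => /(_ _ e20) fl1.
move/cvgrPdist_lt : fl2 => /(_ _ e20) fl2.
apply: filterS2 fl1 fl2 => t /= t1 t2.
rewrite -[X in _ < X]/(e%:C) (splitr e) rmorphD /=.
have -> : l - f t = (complex.Re l - complex.Re (f t))%:C +
   'i * (complex.Im l - complex.Im (f t))%:C.
  by case: (l) => a b; case: (f t) => c d; simpc.
apply: (le_lt_trans (ler_normD _ _)); apply: ltrD.
  by rewrite normc_def /= expr0n /= addr0 sqrtr_sqr ltcR.
rewrite normrM !normc_def /= !expr0n /= addr0 add0r expr1n sqrtr1 mul1r.
by rewrite sqrtr_sqr ltcR.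
Qed.

End complex_cvg.

Section nbv_complex.
Context {R : realType} (tau : R).
Implicit Type f : R -> R[i].

(* `Rcomplex R` and `R[i]^o` are R[i] with, respectively, the R-valued modulus
   and the usual topology. *)
Definition is_cnbv f : Prop :=
  [/\ forall t, t \notin `[- tau, 0] -> f t = 0,
      nbounded_variation (- tau) 0 (f : R -> Rcomplex R),
      forall t, t \in `[- tau, 0[ ->
        (f : R -> R[i]^o) @ t^'+ --> (f t : R[i]^o) &
      f 0 = 0].

Definition cnbv_pred : {pred R -> R[i]} := fun f => `[< is_cnbv f >].

Lemma cnbv_scale_norm l f u v :
  `|(l *: f) u - (l *: f) v : Rcomplex R| =
  ComplexField.Normc.normc l * `|f u - f v : Rcomplex R|.
Proof. by rewrite /= -[RHS]ComplexField.Normc.normcM mulrBr. Qed.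

Lemma cnbv_submod_closed : submod_closed cnbv_pred.
Proof.
split.
  apply/asboolP; split => // [|t _]; last exact: cvg_cst.
  exists 0 => _ [s _ <-]; rewrite /nvariation big1// => i _.
  by rewrite /= subrr normr0.
move=> l f g /asboolP[f0 bf cf fz] /asboolP[g0 bg cg gz]; apply/asboolP; split.
- by move=> t tI; rewrite /= !fctE f0// g0// scaler0 addr0.
- apply: (@nbounded_variationD R (Rcomplex R)) => //.
  apply: (@nbounded_variation_scale R (Rcomplex R) (Rcomplex R) _ _
    `|l : Rcomplex R| f) => // u v.
  by rewrite cnbv_scale_norm.
- move=> t tI; apply: cvgD; last exact: cg.
  by apply: cvgZr; exact: cf.
- by rewrite !fctE fz gz scaler0 addr0.
Qed.

HB.instance Definition _ := GRing.isSubmodClosed.Build R[i] (R -> R[i])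
  cnbv_pred cnbv_submod_closed.

Record cnbv := CNBV { cnbv_fun :> R -> R[i] ; _ : cnbv_fun \in cnbv_pred }.

HB.instance Definition _ := [isSub for cnbv_fun].
HB.instance Definition _ := [Choice of cnbv by <:].
HB.instance Definition _ := [SubChoice_isSubLmodule of cnbv by <:].

Lemma cnbvP (f : cnbv) : is_cnbv f. Proof. by case: f => f /= /asboolP. Qed.

Definition cnbv_rnorm (f : cnbv) : R :=
  fine (ntotal_variation (- tau) 0 (f : R -> Rcomplex R)).

Definition cnbv_norm (f : cnbv) : R[i] := (cnbv_rnorm f)%:C.

Lemma cnbv_normD (f g : cnbv) : cnbv_norm (f + g) <= cnbv_norm f + cnbv_norm g.
Proof.
rewrite -rmorphD lecR.
apply: (@fine_ntotal_variationD R (Rcomplex R)).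
  by case: (cnbvP f).
by case: (cnbvP g).
Qed.

Lemma cnbv_normZ_le l (f : cnbv) : cnbv_norm (l *: f) <= `|l| * cnbv_norm f.
Proof.
rewrite -rmorphM lecR.
apply: (@fine_ntotal_variation_scale R (Rcomplex R) (Rcomplex R)).
- exact: (@normr_ge0 R (Rcomplex R)).
- by move=> u v; rewrite -cnbv_scale_norm.
- by case: (cnbvP f).
Qed.

Lemma cnbv_normZ l (f : cnbv) : cnbv_norm (l *: f) = `|l| * cnbv_norm f.
Proof.
apply/eqP; rewrite eq_le cnbv_normZ_le /=; have [->|l0] := eqVneq l 0.
  rewrite normr0 mul0r lecR.
  apply: (@fine_ntotal_variation_ge0 R (Rcomplex R)).
  by case: (cnbvP (0 *: f)).
rewrite -ler_pdivlMl ?normr_gt0// -normfV.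
apply: le_trans (cnbv_normZ_le _ _).
by rewrite scalerA mulVf// scale1r.
Qed.

Lemma cnbv_norm_eq0 (f : cnbv) : cnbv_norm f = 0 -> f = 0.
Proof.
move=> /(congr1 (@complex.Re R)) /= f0.
apply/val_inj/funext => t /=; have [zf bf _ f00] := cnbvP f.
have [|tI] := boolP (t \in `[- tau, 0]); last by rewrite zf.
rewrite in_itv /= => /(@fine_ntotal_variation_eq0 R (Rcomplex R) _ _ _ _ bf f0).
by rewrite f00.
Qed.

HB.instance Definition _ := Lmodule_isNormed.Build R[i] cnbv
  cnbv_normD cnbv_normZ cnbv_norm_eq0.

Lemma cnbv_normE (f : cnbv) :
  `|f| = (fine (ntotal_variation (- tau) 0 (f : R -> Rcomplex R)))%:C.
Proof. by []. Qed.

Lemma cnbv_re_subproof (f : cnbv) :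
  ((fun t => complex.Re (f t)) : R -> R) \in nbv_pred tau.
Proof.
have [zf bf cf f0] := cnbvP f; apply/asboolP; split.
- by move=> t tI; rewrite zf.
- apply: (@nbounded_variation_scale R (Rcomplex R) R _ _ 1 _ _ _ _ bf) => //.
  move=> u v.
  rewrite mul1r -lecR; apply: le_trans (normc_ge_Re _).
  by case: (f u) => a b; case: (f v).
- by move=> t /cf /cvg_complexP[].
- by rewrite f0.
Qed.

Lemma cnbv_im_subproof (f : cnbv) :
  ((fun t => complex.Im (f t)) : R -> R) \in nbv_pred tau.
Proof.
have [zf bf cf f0] := cnbvP f; apply/asboolP; split.
- by move=> t tI; rewrite zf.
- apply: (@nbounded_variation_scale R (Rcomplex R) R _ _ 1 _ _ _ _ bf) => //.
  move=> u v.
  rewrite mul1r -sqrtr_sqr.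
  case: (f u) => a b; case: (f v) => c d /=.
  by rewrite /Num.norm/= ler_sqrt ?addr_ge0 ?sqr_ge0// lerDr sqr_ge0.
- by move=> t /cf /cvg_complexP[].
- by rewrite f0.
Qed.

Lemma cnbv_of_subproof (g h : nbv tau) :
  ((fun t => g t +i* h t) : R -> R[i]) \in cnbv_pred.
Proof.
have [zg bg cg g0] := nbvP g; have [zh bh ch h0] := nbvP h.
apply/asboolP; split.
- by move=> t tI; rewrite zg// zh.
- have gh : (fun t => g t +i* h t) =
     (fun t => (g t)%:C) + (fun t => 0 +i* h t) :> (R -> Rcomplex R).
    by apply/funext => t; rewrite fctE; simpc.
  rewrite gh; apply: nbounded_variationD.
    apply: (@nbounded_variation_scale R R (Rcomplex R) _ _ 1 _ _ _ _ bg) => //.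
    move=> u v.
    by rewrite mul1r /Num.norm /= subr0 expr0n /= addr0 sqrtr_sqr.
  apply: (@nbounded_variation_scale R R (Rcomplex R) _ _ 1 _ _ _ _ bh) => //.
  move=> u v.
  by rewrite mul1r /Num.norm /= subr0 expr0n /= add0r sqrtr_sqr.
- move=> t tI; apply/cvg_complexP; split; [exact: cg|exact: ch].
- by rewrite g0 h0.
Qed.

Definition cnbv_re (f : cnbv) : nbv tau := NBV (cnbv_re_subproof f).
Definition cnbv_im (f : cnbv) : nbv tau := NBV (cnbv_im_subproof f).
Definition cnbv_of (g h : nbv tau) : cnbv := CNBV (cnbv_of_subproof g h).

Definition complexification (U : nbv tau -> nbv tau) (f : cnbv) : cnbv :=
  cnbv_of (U (cnbv_re f)) (U (cnbv_im f)).

End nbv_complex.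

Section bounded_variation_lemmas.
Context {R : realType}.
Implicit Types (a b c : R) (f g : R -> R).

Lemma bounded_variation_bounded a b g : a <= b -> bounded_variation a b g ->
  exists2 M, 0 <= M & forall u, a <= u <= b -> `|g u| <= M.
Proof.
move=> ab bg; exists (fine (total_variation a b g) + `|g b|).
  by rewrite addr_ge0// (@fine_ntotal_variation_ge0 R R).
move=> u /andP[au ub].
rewrite -[g u](subrK (g b)) (le_trans (ler_normD _ _))// lerD2r.
have bug := bounded_variationr au ub bg.
have bag := bounded_variationl au ub bg.
rewrite distrC -lee_fin; apply: (le_trans (total_variation_ge g ub)).
rewrite -[leLHS]fineK; last exact/bounded_variationP.
rewrite (total_variationD _ au ub) fineD; [|exact/bounded_variationP..].
by rewrite lee_fin lerDr (@fine_ntotal_variation_ge0 R R).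
Qed.

Lemma bounded_variationM a b f g : a <= b -> bounded_variation a b f ->
  bounded_variation a b g -> bounded_variation a b (fun t => f t * g t).
Proof.
move=> ab bf bg.
have [M M0 fM] := bounded_variation_bounded ab bf.
have [N N0 gN] := bounded_variation_bounded ab bg.
have [A fA] := bf; have [B gB] := bg.
exists (N * A + M * B) => _ [s ps <-].
have : variation a b (fun t => f t * g t) s <=
    N * variation a b f s + M * variation a b g s.
  rewrite /variation !mulr_sumr -big_split /=.
  rewrite !big_nat; apply: ler_sum => i /andP[_ si].
  have := itv_partition_nth_ge (si : (i.+1 < (size s).+1)%N) ps.
  have := itv_partition_nth_le (si : (i.+1 < (size s).+1)%N) ps.
  have := itv_partition_nth_ge (ltnW si : (i < (size s).+1)%N) ps.
  have := itv_partition_nth_le (ltnW si : (i < (size s).+1)%N) ps.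
  move=> /= ub au vb av.
  set u := nth b (a :: s) i in ub au *; set v := nth b s i in vb av *.
  have -> : f v * g v - f u * g u = g u * (f v - f u) + f v * (g v - g u).
    by rewrite !mulrBr [g u * f v]mulrC [g u * f u]mulrC [RHS]addrC addrA subrK.
  rewrite (le_trans (ler_normD _ _))// !normrM lerD// ler_wpM2r//.
    by rewrite gN// au ub.
  by rewrite fM// av vb.
move=> /le_trans; apply; rewrite lerD// ler_wpM2l//.
  by apply: fA; exists s.
by apply: gB; exists s.
Qed.

Lemma bounded_variation_shift a b c f : bounded_variation (c + a) (c + b) f ->
  bounded_variation a b (fun t => f (c + t)).
Proof.
move=> [M fM]; exists M => _ [s ps <-].
apply: fM; exists (map (+%R c) s).
  case: ps => ps /eqP <-; split; last by rewrite last_map.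
  by apply: homo_path ps => u v; rewrite ltrD2l.
have nthD l i : nth (c + b) (map (+%R c) l) i = c + nth b l i.
  by elim: l i => [|x l ih] [|i] //=.
rewrite /variation size_map; apply: eq_bigr => i _ /=.
by rewrite -nthD -(nthD (a :: s)).
Qed.

Lemma at_right_shift c t : (c + u) @[u --> t^'+] --> (c + t)^'+.
Proof.
move=> A [e /= e0 eA]; exists e => //= u; rewrite /ball_ /= => tu ltu.
apply: eA => /=; last by rewrite ltrD2l.
by rewrite opprD addrACA subrr add0r.
Qed.

End bounded_variation_lemmas.

Section monodromy.
Context {R : realType} (f : R -> R) (tau : R).
Implicit Types (phi x : R -> R).

Definition is_solution phi x : Prop :=
  (forall t, t \in `[- tau, 0[ -> x t = phi t) /\
  (forall t, 0 <= t -> x t = f t * x (t - tau)).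

(* The values of a solution on ]-oo, -tau[ are irrelevant and unconstrained;
   see `solution_exists` and `solution_unique`. *)
Definition solution phi : R -> R :=
  xget (fun=> 0) [set x | is_solution phi x].

(* x_t as an element of NBV([-tau, 0]): the value at 0 is normalized to 0. *)
Definition segment x t : R -> R :=
  fun u => if - tau <= u < 0 then x (t + u) else 0.

(* `insubd 0` returns 0 when the segment is not in `nbv tau`; `monodromyE`
   shows that this does not happen for the coefficients f considered. *)
Definition monodromy (phi : nbv tau) : nbv tau :=
  insubd 0 (segment (solution phi) tau).

End monodromy.

Arguments solution {R} f tau phi.
Arguments monodromy {R} f tau phi.

Section monodromy_lemmas.
Context {R : realType} (f : R -> R) (tau : R) (tau0 : 0 < tau).
Implicit Types (phi x y : R -> R).

Lemma solution_unique phi x y : is_solution f tau phi x ->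
  is_solution f tau phi y -> forall t, - tau <= t -> x t = y t.
Proof.
move=> [x0 xf] [y0 yf] t tt.
have [n] : exists n : nat, t < tau *+ n.
  exists (Num.bound (t / tau)).
  rewrite -mulr_natl -ltr_pdivrMr//.
  have [t0|t0] := leP 0 t; first by rewrite archi_boundP// divr_ge0// ltW.
  by rewrite (lt_le_trans _ (ler0n _ _))// pmulr_llt0// invr_gt0.
elim: n t tt => [|n ih] t tt tn.
  by rewrite x0 ?y0// in_itv /= tt; rewrite mulr0n in tn.
have [t0|t0] := leP 0 t; last by rewrite x0 ?y0// in_itv /= tt t0.
rewrite xf// yf// ih//; first by rewrite -[X in X <= _]add0r lerD2r.
by rewrite ltrBlDr -mulrSr.
Qed.

Lemma solution_exists phi : exists x, is_solution f tau phi x.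
Proof.
pose g := fix g (n : nat) t := if t < 0 then phi t else
  if n is m.+1 then f t * g m (t - tau) else 0.
have gS n m t : t < tau *+ n -> (n <= m)%N -> g m t = g n t.
  elim: n m t => [|n ih] [|m] t //; rewrite ?mulr0n => tn nm /=.
    by rewrite tn.
  case: ifPn => // t0; congr (_ * _); apply: ih => //.
  by rewrite ltrBlDr -mulrSr.
pose b t := Num.bound (t / tau).
have tb t : 0 <= t -> t < tau *+ b t.
  move=> t0.
  by rewrite -mulr_natl -ltr_pdivrMr// archi_boundP// divr_ge0// ltW.
exists (fun t => g (b t) t); split => [t|t t0].
  by rewrite in_itv /= => /andP[_ t0]; case: (b t) => [|n] /=; rewrite t0.
have t1 := tb _ t0.
rewrite -(gS _ (b t).+1 t t1)//.
have -> : g (b t).+1 t = f t * g (b t) (t - tau) by rewrite /= ltNge t0.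
congr (_ * _).
have [tt|tt] := ltP (t - tau) 0; last first.
  have t2 := tb _ tt.
  have [le_b|/ltnW le_b] := leqP (b (t - tau)) (b t).
    exact: gS t2 le_b.
  apply/esym/gS => //; apply: lt_trans t1.
  by rewrite ltrBlDr ltrDl.
by case: (b t) => [|n]; case: (b (t - tau)) => [|m] /=; rewrite tt.
Qed.

Lemma solutionP phi : is_solution f tau phi (solution f tau phi).
Proof. exact: xgetPex (solution_exists phi). Qed.

Lemma monodromyE (phi : nbv tau) : right_continuous f ->
  (forall a b, a <= b -> bounded_variation a b f) ->
  monodromy f tau phi = segment tau (solution f tau phi) tau :> (R -> R).
Proof.
move=> cf bf; have [x0 xf] := solutionP phi; have [zp bp cp p0] := nbvP phi.
have segE : segment tau (solution f tau phi) tau = fun u => f (tau + u) * phi u.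
  apply/funext => u; rewrite /segment; case: ifPn => [/andP[u1 u2]|uI].
    rewrite xf; last by rewrite addrC -lerBlDr sub0r.
    by rewrite addrAC subrr add0r x0// in_itv /= u1.
  have [->|u0] := eqVneq u 0; first by rewrite p0 mulr0.
  by rewrite zp ?mulr0// in_itv /= [u <= 0]le_eqVlt (negbTE u0).
rewrite /monodromy insubdK// segE; apply/asboolP; split.
- by move=> t tI; rewrite zp ?mulr0.
- apply: bounded_variationM => //; first by rewrite oppr_le0 ltW.
  apply: bounded_variation_shift; rewrite subrr addr0; exact/bf/ltW.
- move=> t tI; apply: cvgM; last exact: cp.
  by move=> A /(cf (tau + t)); exact: at_right_shift.
- by rewrite p0 mulr0.
Qed.

End monodromy_lemmas.

Section minimal_period.
Context {R : realType}.
Implicit Types (f : R -> R) (p : R).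

Definition minimal_period f p : Prop :=
  [/\ 0 < p, periodic f p & forall q, 0 < q < p -> ~ periodic f q].

Definition is_segment (I : set R) : Prop :=
  is_interval I /\ exists a b, [/\ I a, I b & a < b].

End minimal_period.

(* Main.v *)
(** On [-tau, 0[ the monodromy operator is multiplication by [f (tau + t)], so
    [U phi = l phi] means that [f (tau + t) = l] wherever [phi t <> 0].  By right
    continuity a nonzero [phi] has no zero on some interval [t, t + e[, on which
    the shifted [f] must then equal [l].  Conversely, by periodicity a segment
    on which [f = l] can be moved so that its shift meets [-tau, 0[ in a
    segment, whose indicator function is an eigenvector. *)
Require Import Defs.
From mathcomp Require Import all_boot all_order all_algebra.
From mathcomp Require Import all_classical all_reals all_analysis.
From mathcomp Require Import complex.
From mathcomp Require Import lra.

Import Order.TTheory GRing.Theory Num.Theory.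
Import numFieldNormedType.Exports.

Local Open Scope classical_set_scope.
Local Open Scope complex_scope.
Local Open Scope ring_scope.

Lemma periodicz (U V : zmodType) (f : U -> V) (p : U) (z : int) (a : U) :
  periodic f p -> f (a + p *~ z) = f a.
Proof.
move=> fp; case: z => n; first exact: periodicn.
by rewrite NegzE mulrNz -[in RHS](subrK (p *~ n.+1) a) [RHS]periodicn.
Qed.

(** A resolvent is in particular a left inverse, which forces injectivity. *)
Lemma point_spectrum_sub (K : numFieldType) (V : normedModType K) (T : V -> V) :
  point_spectrum T `<=` spectrum T.
Proof.
by move=> l Tl [S [_ ST _]]; apply: Tl => u v /(congr1 S); rewrite !ST.
Qed.

Section monodromy_multiplication.
Context {R : realType} (f : R -> R) (tau : R).
Hypotheses (tau_gt0 : 0 < tau) (f_rc : right_continuous f).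
Hypothesis f_bv : forall a b, a <= b -> bounded_variation a b f.

(** Valid for every real [t]: outside [[-tau, 0[] both sides vanish, at 0 because of the
    normalization [phi 0 = 0]. *)
Lemma monodromy_mul (phi : nbv tau) t :
  monodromy f tau phi t = f (tau + t) * phi t.
Proof.
rewrite monodromyE//; have [x0 xf] := solutionP f tau_gt0 phi.
have [zp _ _ p0] := nbvP phi; rewrite /segment; case: ifPn => [/andP[t1 t2]|tI].
  rewrite xf; last by rewrite addrC -lerBlDr sub0r.
  by rewrite addrAC subrr add0r x0// in_itv /= t1.
have [->|t0] := eqVneq t 0; first by rewrite p0 mulr0.
by rewrite zp ?mulr0// in_itv /= [t <= 0]le_eqVlt (negbTE t0).
Qed.

Lemma complexification_monodromy_mul (phi : cnbv tau) t :
  complexification (monodromy f tau) phi t = (f (tau + t))%:C * phi t.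
Proof.
by rewrite /= !monodromy_mul /=; case: (phi t) => a b; simpc.
Qed.

End monodromy_multiplication.

Section indicator.
Context {R : realType} (tau : R).
Implicit Types a b c : R.

Lemma cvg_at_right_step c t :
  (c <= u)%R%:R @[u --> t^'+] --> ((c <= t)%R%:R : R).
Proof.
apply: (@cvg_near_cst _ R^o); have [ct|tc] := leP c t.
  by near=> u; rewrite (le_trans ct)//; near: u; exact: nbhs_right_ge.
by near=> u; rewrite lt_geF//; near: u; exact: nbhs_right_lt.
Unshelve. all: by end_near. Qed.

Lemma bounded_variation_step a b c : a <= b ->
  bounded_variation a b (fun t => (c <= t)%R%:R : R).
Proof.
move=> ab; apply: nondecreasing_bounded_variation => u v _ _ uv.
by rewrite ler_nat; have [/le_trans->|_] := leP c u.
Qed.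

(** The indicator is a difference of two nondecreasing right-continuous steps. Excluding [b] gives
    right continuity there, and the value 0 at 0 even when [b = 0]. *)
Lemma is_nbv_indicator a b : - tau <= a -> a <= b -> b <= 0 ->
  is_nbv tau (fun t => (a <= t < b)%R%:R).
Proof.
move=> ta ab b0.
have -> : (fun t => (a <= t < b)%R%:R : R) =
    (fun t => (a <= t)%R%:R - (b <= t)%R%:R).
  apply/funext => t; case: (leP b t) => [bt|tb]; last by rewrite andbT subr0.
  by rewrite (le_trans ab bt) subrr.
split.
- move=> t; rewrite in_itv /= negb_and -!ltNge => /orP[tt|t0].
    by rewrite !lt_geF ?subrr//; lra.
  have bt := ltW (le_lt_trans b0 t0).
  by rewrite bt (le_trans ab bt) subrr.
- apply: (@nbounded_variationD R R); first by apply: bounded_variation_step; lra.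
  by apply/bounded_variationN/bounded_variation_step; lra.
- by move=> t _; apply: cvgB; exact: cvg_at_right_step.
- by rewrite b0 (le_trans ab b0) subrr.
Qed.

End indicator.

Section eigenvectors.
Context {R : realType} (f : R -> R) (tau : R) (l : R[i]).
Hypotheses (tau_gt0 : 0 < tau) (f_rc : right_continuous f).
Hypothesis f_bv : forall a b, a <= b -> bounded_variation a b f.

Let UC := complexification (monodromy f tau).
Let level : set R := [set t | (f t)%:C = l].

Lemma complexification_sub_scale (phi : cnbv tau) t :
  (UC phi - l *: phi) t = ((f (tau + t))%:C - l) * phi t.
Proof. by rewrite mulrBl -complexification_monodromy_mul. Qed.

Lemma point_spectrum_level : point_spectrum UC l -> level° !=set0.
Proof.
move=> Ul; have [[phi psi] /= /not_implyP[Uphi phi_psi]] :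
    exists u : cnbv tau * cnbv tau,
      ~ (UC u.1 - l *: u.1 = UC u.2 - l *: u.2 -> u.1 = u.2).
  by apply/existsNP => inj; apply: Ul => u v; exact: (inj (u, v)).
have [zd _ cd d0] := cnbvP (phi - psi).
have [t dt] : exists t, (phi - psi) t != 0.
  apply: contra_notP phi_psi => /forallNP dz.
  apply/subr0_eq/val_inj/funext => t.
  by apply/eqP; apply: contra_notT (dz t).
have tI : t \in `[- tau, 0[.
  have : t \in `[- tau, 0] by apply: contraNT dt => /zd ->.
  rewrite !in_itv /= => /andP[-> /=]; rewrite le_eqVlt => /predU1P[t0|//].
  by move: dt; rewrite t0 d0 eqxx.
(* Subtracting the two pointwise identities leaves [(f (tau + u) - l) * (phi - psi) u = 0]. *)
have fl u : (phi - psi) u != 0 -> level (tau + u).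
  move=> du; move/(congr1 (fun g : cnbv tau => g u)): Uphi.
  rewrite !complexification_sub_scale => Uu.
  apply/eqP; rewrite -subr_eq0; apply/eqP/(mulIf du).
  by rewrite mul0r [X in _ * X = _]/(phi u - psi u) mulrBr Uu subrr.
have : \forall u \near t^'+, level (tau + u).
  by apply: filterS fl _; apply: (@cvgr_neq0 _ R[i]^o _ _ _ _ _ (cd t tI) dt).
(* The one-sided neighbourhood []t, t + e[], shifted by [tau], is the ball about its midpoint. *)
move=> [e /= e0 eA]; exists (tau + (t + e / 2)), (e / 2) => /=.
  by rewrite divr_gt0.
move=> u /=; rewrite ltr_distlC => /andP[u1 u2].
rewrite -[u](subrK tau) addrC; apply: eA => /=; last by lra.
by rewrite ltr_distlC; lra.
Qed.

Lemma level_point_spectrum (I : set R) : periodic f tau -> is_segment I ->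
  I `<=` level -> point_spectrum UC l.
Proof.
move=> fp [Iitv [a [b [Ia Ib ab]]]] Il.
(* The [+ 1] moves [a] by a multiple of the period into [[-tau, 0[] rather than [[0, tau[]. *)
pose z : int := Num.floor (a / tau) + 1; pose s : R := tau *~ z.
have /andP[sa as_] : - tau <= a - s < 0.
  have /andP[] := floor_itv (a / tau).
  rewrite ler_pdivlMr// ltr_pdivrMr// => za az.
  by rewrite /s /z -mulrzr intrD1; lra.
(* The shifted segment may run past 0; cutting it there leaves positive length, since
   [a - s < 0]. *)
pose b' : R := Num.min (b - s) 0.
have ab' : a - s < b' by rewrite /b' lt_min as_ andbT; lra.
have b'0 : b' <= 0 by rewrite /b' ge_min lexx orbT.
have phiP := is_nbv_indicator _ _ _ sa (ltW ab') b'0.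
pose phi : cnbv tau := cnbv_of (NBV (introT (asboolP _) phiP)) 0.
have phi_eigen : UC phi - l *: phi = UC 0 - l *: 0.
  apply/val_inj/funext => t.
  suff: (UC phi - l *: phi) t = (UC 0 - l *: 0) t by [].
  rewrite !complexification_sub_scale mulr0.
  case: (boolP (a - s <= t < b')) => [/andP[st tb]|tI]; last first.
    by rewrite /= (negbTE tI) mulr0.
  have fl : level (tau + t).
    (* This point is [t + s], which lies between [a] and [b]; the [tau] in the argument of [f]
       accounts for one of the [z] periods. *)
    have sI : I (tau + t + tau *~ (z - 1)).
      apply: (Iitv _ _ Ia Ib); move: st tb.
      by rewrite /b' lt_min /s mulrzBr mulr1z; lra.
    by rewrite /level /= -(Il _ sI) periodicz.
  by rewrite fl subrr mul0r.
(* Injectivity would give [phi = 0], but [phi] is 1 at the left endpoint [a - s]. *)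
move=> /(_ _ _ phi_eigen).
move=> /(congr1 (fun g : cnbv tau => complex.Re (g (a - s)))).
by rewrite /= lexx ab' => /eqP; rewrite oner_eq0.
Qed.

End eigenvectors.

Lemma interior_segment (R : realType) (A : set R) : A° !=set0 ->
  exists2 I : set R, is_segment I & I `<=` A.
Proof.
move=> [t [e /= e0 eA]]; exists (ball t e) => //; split.
  by rewrite ball_itv; exact: interval_is_interval.
exists t, (t + e / 2); split; [exact: ballxx| |by rewrite ltrDl divr_gt0].
by rewrite /ball /= opprD addrA subrr add0r normrN gtr0_norm; lra.
Qed.

Theorem theorem4 (R : realType) (tau : R) (f : R -> R)
    (tau_gt0 : 0 < tau)
    (f_bv : forall a b : R, a <= b -> bounded_variation a b f)
    (f_rc : right_continuous f)
    (f_per : (exists c : R, f = cst c) \/ minimal_period f tau) :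
  let UC := complexification (monodromy f tau) in
  let level (l : R[i]) : set R := [set t : R | (f t)%:C = l] in
  point_spectrum UC =
    [set l | spectrum UC l /\ (level l)° !=set0] /\
  point_spectrum UC =
    [set l | spectrum UC l /\ exists2 I : set R, is_segment I & I `<=` level l].
Proof.
move=> UC level.
(* A constant function also has period [tau], so both cases continue together. *)
have fp : periodic f tau by case: f_per => [[c ->]|[]].
have spec := @point_spectrum_sub _ _ UC.
have int l : point_spectrum UC l -> (level l)° !=set0.
  exact: point_spectrum_level.
have pt l : (exists2 I, is_segment I & I `<=` level l) -> point_spectrum UC l.
  by move=> [I Iseg Il]; exact: level_point_spectrum fp Iseg Il.
split; apply/seteqP; split => l.
- by move=> Ul; split; [exact: spec|exact: int].
- by move=> [_ /interior_segment/pt].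
- by move=> Ul; split; [exact: spec|exact/interior_segment/int].
- by move=> [_ /pt].
Qed.
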